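(* Let $G$ be a group whose power graph $P(G)$ has finite independence number. Then the independence number and the clique cover number of $P(G)$ are equal.
   Context: The power graph $P(G)$ of a group $G$ is the undirected graph with vertex set $G$ in which two distinct elements are adjacent if and only if one of them is a positive power of the other. The independence number of a graph is the cardinality of a largest independent set (set of pairwise non-adjacent vertices). A clique is a set of pairwise adjacent vertices (possibly infinite); the clique cover number is the minimum number of parts in a partition of the vertex set into cliques. *)

(* Defs.v *)
From HB Require Import structures.
From mathcomp Require Import all_boot.
From mathcomp Require Import classical_sets cardinality.
Set Implicit Arguments.
Unset Strict Implicit.
Unset Printing Implicit Defensive.

Local Open Scope classical_set_scope.
Local Open Scope card_scope.
Local Open Scope group_scope.

Record sgraph (V : Type) := SGraph {
  adj : V -> V -> Prop;
  adj_sym : forall x y, adj x y -> adj y x;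
  adj_irrefl : forall x, ~ adj x x
}.

Definition independent V (Gr : sgraph V) (A : set V) : Prop :=
  forall x y, A x -> A y -> ~ adj Gr x y.

Definition clique V (Gr : sgraph V) (K : set V) : Prop :=
  forall x y, K x -> K y -> x <> y -> adj Gr x y.

(* The cardinal invariants are given as relations "the invariant exists and
   equals the natural number n"; n is then unique, and the invariant is finite
   precisely when some such n exists. *)
Definition is_independence_number V (Gr : sgraph V) (n : nat) : Prop :=
  (exists2 A : set V, independent Gr A & A #= `I_n) /\
  (forall A : set V, independent Gr A -> A #<= `I_n).

(* The partition is the set of sets P, viewed as a family indexed by itself. *)
Definition clique_partition V (Gr : sgraph V) (P : set (set V)) : Prop :=
  partition P id [set: V] /\ (forall K, P K -> clique Gr K).

(* P ranges over all clique partitions, including infinite ones. *)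
Definition is_clique_cover_number V (Gr : sgraph V) (n : nat) : Prop :=
  (exists2 P : set (set V), clique_partition Gr P & P #= `I_n) /\
  (forall P : set (set V), clique_partition Gr P -> `I_n #<= P).

Definition positive_power (G : groupType) (x y : G) : Prop :=
  exists2 m : nat, (0 < m)%N & y = x ^+ m.

Definition power_adj (G : groupType) (x y : G) : Prop :=
  x <> y /\ (positive_power x y \/ positive_power y x).

Lemma power_adj_sym (G : groupType) (x y : G) :
  power_adj x y -> power_adj y x.
Proof.
by case=> nxy [pxy|pyx]; split; [exact: nesym|right|exact: nesym|left].
Qed.

Lemma power_adj_irrefl (G : groupType) (x : G) : ~ power_adj x x.
Proof. by case. Qed.

(* G is an arbitrary, possibly infinite, group: the choice structure contained
   in groupType exists on every type under the classical axioms. *)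
Definition power_graph (G : groupType) : sgraph G :=
  SGraph (@power_adj_sym G) (@power_adj_irrefl G).

(* Main.v *)
Require Import Defs.
From mathcomp Require Import all_boot.
From mathcomp Require Import finmap boolp classical_sets cardinality filter.
Set Implicit Arguments.
Unset Strict Implicit.
Unset Printing Implicit Defensive.

(** The relation saying that one element is a positive power of another is
    reflexive and transitive, so the power graph is the comparability graph of
    a preorder: independent sets are its antichains and cliques are its chains.
    The theorem is then Dilworth's theorem for a preorder of finite width n on
    a possibly infinite set ([dilworth]): such a preorder is covered by n
    chains. The group is involved only through this preorder.

    On a finite set, Dilworth's theorem [finite_dilworth] is proved by Galvin's
    induction. Remove a maximal element a and split the rest into as many
    chains as its width k. In each chain take the highest element that lies in
    an antichain of size k; these tops form an antichain. If a is incomparable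
    with all of them, they form together with a an antichain of size k + 1, so
    a may be given a chain of its own. Otherwise a lies above some top x, and a
    together with the part of the chain of x below x is a chain. Its removal
    makes the width drop, because every antichain of size k in the rest meets
    the chain of x, and does so below x.

    The infinite case follows by compactness. Each finite list s of elements
    has a coloring c s by n colors whose classes are chains, and an ultrafilter
    on the lists, containing for each s0 the set of all lists that include s0,
    selects for each x the color that almost all the c s give to x. Two elements
    with the same limit color get the same color from some c s with both of them
    in s, so they are comparable.

    A coloring with n colors yields a clique partition once its classes are
    known to be nonempty: an antichain with n elements meets each of them
    ([full_antichain_colors]). Conversely, distinct elements of that antichain
    lie in distinct parts of any clique partition, so no such partition has
    fewer than n parts. *)

(** * Finite preorders *)

Definition related (T : Type) (e : rel T) (x y : T) : bool := e x y || e y x.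

(** In a preorder, equivalent elements are related, so an antichain contains
    at most one element of each equivalence class. *)
Definition antichain (T : Type) (e : rel T) (A : {pred T}) : Prop :=
  {in A &, forall x y, related e x y -> x = y}.

Definition chain_coloring (T : Type) (e : rel T) (k : nat) (A : {pred T})
    (f : T -> nat) : Prop :=
  {in A, forall x, f x < k} /\
  {in A &, forall x y, f x = f y -> related e x y}.

Lemma relatedC (T : Type) (e : rel T) (x y : T) :
  related e x y = related e y x.
Proof. exact: orbC. Qed.

Lemma chain_coloring_inj (T : Type) (e : rel T) k (A B : {pred T}) f :
  chain_coloring e k A f -> antichain e B -> {subset B <= A} ->
  {in B &, injective f}.
Proof.
move=> [_ fA] antiB sBA x y xB yB /fA fxy.
by apply: antiB => //; apply: fxy; apply: sBA.
Qed.

(** Pigeonhole: the elements of an antichain have distinct colors, so k of them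
    use all k colors. *)
Lemma full_antichain_colors (T : eqType) (e : rel T) k (A : {pred T}) f
    (s : seq T) :
  chain_coloring e k A f -> antichain e [in s] -> {subset s <= A} ->
  uniq s -> size s = k -> forall i, i < k -> exists2 x, x \in s & f x = i.
Proof.
move=> fP antis ssA us sz i ltik; have [fltk _] := fP.
have /mapP[x xs ->] : i \in map f s; last by exists x.
have umap : uniq (map f s).
  by rewrite map_inj_in_uniq//; apply: chain_coloring_inj fP antis ssA.
have sub : {subset map f s <= iota 0 k}.
  by move=> _ /mapP[x xs ->]; rewrite mem_iota add0n fltk// ssA.
have szle : size (iota 0 k) <= size (map f s) by rewrite size_iota size_map sz.
by have [_ ->] := uniq_min_size umap sub szle; rewrite mem_iota.
Qed.

Lemma full_antichain_colors_set (T : finType) (e : rel T) k (P B : {set T}) f :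
  chain_coloring e k [in P] f -> antichain e [in B] -> B \subset P ->
  #|B| = k -> forall i, i < k -> exists2 x, x \in B & f x = i.
Proof.
move=> fP antiB /fintype.subsetP BP cardB i ltik.
have [||||x] := full_antichain_colors (s := enum B) fP _ _ _ _ ltik.
- by move=> x y; rewrite -!topredE /= !mem_enum; apply: antiB.
- by move=> x; rewrite mem_enum; apply: BP.
- exact: enum_uniq.
- by rewrite -cardE.
by rewrite mem_enum; exists x.
Qed.

Section FinitePreorder.
Variables (T : finType) (e : rel T).
Hypotheses (e_refl : reflexive e) (e_trans : transitive e).

(** An element of [P] with the largest down-set is maximal: anything above it
    has a larger, hence the same, down-set. *)
Lemma maximal_exists (P : {set T}) x0 : x0 \in P ->
  exists2 x, x \in P & {in P, forall y, e x y -> e y x}.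
Proof.
move=> x0P; pose down x := [set y | e y x].
case: (@arg_maxnP _ x0 [in P] (fun x => #|down x|) x0P) => x xP xmax.
exists x => // y yP exy; have /subset_leqif_cards dP : down x \subset down y.
  by apply/fintype.subsetP => z; rewrite !inE => /e_trans; apply.
have : down x == down y by rewrite -dP.2 eqn_leq dP.1; apply: xmax.
by move/eqP/setP/(_ y); rewrite !inE e_refl => ->.
Qed.

Definition on_antichain k (P : {set T}) : {set T} :=
  [set z | `[< exists B : {set T},
     [/\ B \subset P, antichain e [in B], #|B| = k & z \in B] >]].

Lemma on_antichainP k (P : {set T}) z :
  reflect (exists B : {set T},
    [/\ B \subset P, antichain e [in B], #|B| = k & z \in B])
    (z \in on_antichain k P).
Proof. by rewrite /on_antichain inE; apply: asboolP. Qed.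

(** Every color class contains elements of antichains of size [k], hence has a
    top one [x i] among them. If [x i] were below [x j], the antichain of size
    [k] through [x j] would contain an element of color [i], which is below
    [x i] and hence below [x j]. *)
Lemma tops_antichain k (P : {set T}) f :
  chain_coloring e k [in P] f ->
  (exists B : {set T}, [/\ B \subset P, antichain e [in B] & #|B| = k]) ->
  exists x : 'I_k -> T,
    [/\ forall i, x i \in P, forall i, f (x i) = i,
        forall i : 'I_k, {in on_antichain k P, forall z, f z = i -> e z (x i)}
      & forall i j, related e (x i) (x j) -> i = j].
Proof.
move=> fP [B0 [B0P antiB0 cardB0]].
pose D := on_antichain k P; have DP z : z \in D -> z \in P.
  by move=> /on_antichainP[B [/fintype.subsetP BP _ _ /BP]].
have top (i : 'I_k) : exists x, [/\ x \in D, f x = i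
    & {in D, forall z, f z = i -> e z x}].
  have [z0 z0B fz0] :=
    full_antichain_colors_set fP antiB0 B0P cardB0 (ltn_ord i).
  have z0D : z0 \in [set z in D | f z == i].
    by rewrite inE fz0 eqxx andbT; apply/on_antichainP; exists B0.
  have [x] := maximal_exists z0D.
  rewrite inE => /andP[xD /eqP fx] xmax; exists x; split=> // z zD fz.
  have /orP[//|] : related e z x by apply: fP.2; rewrite ?fx ?fz// DP.
  by apply: xmax; rewrite inE zD fz eqxx.
have [x xP] := fin_all_exists top.
exists x; split=> [i|i|i|]; try by case: (xP i) => // /DP.
have le_eq i j : e (x i) (x j) -> i = j.
  move=> eij; have [/on_antichainP[B [BP antiB cB xB]] fxj _] := xP j.
  have [y yB fy] := full_antichain_colors_set fP antiB BP cB (ltn_ord i).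
  have yD : y \in D by apply/on_antichainP; exists B.
  have [_ _ /(_ y yD fy) eyi] := xP i.
  have /antiB : related e y (x j) by rewrite /related (e_trans eyi eij).
  by move=> /(_ yB xB) yxj; apply/val_inj; rewrite /= -fy yxj fxj.
by move=> i j /orP[/le_eq//|/le_eq].
Qed.

(** Galvin's induction, on the number of elements of [P]: [w] is the width of
    [P] without its maximal element [a]. *)
Lemma finite_dilworth k (P : {set T}) :
  (forall B : {set T}, B \subset P -> antichain e [in B] -> #|B| <= k) ->
  exists f, chain_coloring e k [in P] f.
Proof.
have [m] := ubnP #|P|; elim: m k P => // m IHm k P; rewrite ltnS => cardP wP.
have [->|[a0 a0P]] := set_0Vmem P.
  by exists (fun=> 0); split=> x; rewrite inE.
have [a aP amax] := maximal_exists a0P.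
pose Q := P :\ a; have QP : Q \subset P by exact: subsetDl.
have cardQ : #|Q| < m.
  by rewrite (leq_trans _ cardP)// (cardsD1 a P) aP add1n ltnS.
pose good (w : nat) :=
  `[< exists B : {set T}, [/\ B \subset Q, antichain e [in B] & #|B| = w] >].
have good0 : exists w, good w.
  exists 0; apply/asboolP; exists finset.set0.
  rewrite cards0 finset.sub0set; split=> // x.
  by rewrite inE.
have goodk w : good w -> w <= k.
  move=> /asboolP[B [BQ antiB <-]]; apply: wP antiB.
  exact: fintype.subset_trans QP.
case: (ex_maxnP good0 goodk) => w gw wmax.
have wQ (B : {set T}) : B \subset Q -> antichain e [in B] -> #|B| <= w.
  by move=> BQ antiB; apply: wmax; apply/asboolP; exists B.
have [f fP] := IHm w Q cardQ wQ.
have [x [xQ fx xtop xanti]] := tops_antichain fP (asboolW gw).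
have [[i arel]|anorel] := pselect (exists i, related e a (x i)); last first.
  (* [a] extends the antichain of tops, so [w] itself is a color below [k]. *)
  have aA : a \notin [set x i | i : 'I_w].
    apply/imsetP => -[i _ axi]; apply: anorel; exists i.
    by rewrite -axi /related e_refl.
  have ltwk : w < k.
    have xinj : injective x.
      by move=> i j xij; apply: xanti; rewrite xij /related e_refl.
    have := cardsU1 a [set x i | i : 'I_w].
    rewrite aA add1n (card_imset _ xinj) card_ord => <-; apply: wP.
      apply/fintype.subsetP => y /setU1P[->//|/imsetP[i _ ->]].
      exact: (fintype.subsetP QP).
    move=> y z /setU1P[->|/imsetP[i _ ->]] /setU1P[->|/imsetP[j _ ->]] //.
    - by move=> aj; case: anorel; exists j.
    - by rewrite relatedC => ai; case: anorel; exists i.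
    - by move/xanti->.
  exists (fun y => if y == a then w else f y); split=> [y yP|y z yP zP].
    case: eqP => // /eqP ya; apply: leq_trans (ltnW ltwk).
    by apply: fP.1; rewrite !inE ya.
  have inQ u : u \in P -> u != a -> u \in Q by move=> uP ua; rewrite !inE ua.
  case: eqVneq => [->|ya]; case: eqVneq => [->|za].
  - by rewrite /related e_refl.
  - by move=> wz; have := fP.1 z (inQ z zP za); rewrite -wz ltnn.
  - by move=> wy; have := fP.1 y (inQ y yP ya); rewrite wy ltnn.
  - by apply: fP.2; apply: inQ.
have exa : e (x i) a.
  by case/orP: arel => // eax; apply: amax => //; apply: (fintype.subsetP QP).
have w_gt0 : 0 < w by apply: leq_ltn_trans (ltn_ord i).
(* The chain to remove consists of [a] and the part of the [i]-th chain below
   its top [x i]; [R] is what remains. *)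
pose R := [set y in Q | ~~ ((f y == i) && e y (x i))].
have RQ : R \subset Q by apply/fintype.subsetP => y; rewrite inE => /andP[].
(* An antichain of size [w] inside [R] would contain an element of color [i];
   it would lie below [x i], that is, outside [R]. *)
have wR (B : {set T}) : B \subset R -> antichain e [in B] -> #|B| <= w.-1.
  move=> BR antiB; have BQ := fintype.subset_trans BR RQ.
  rewrite -ltnS prednK// ltn_neqAle wQ// andbT; apply/eqP => cardB.
  have [z zB fz] := full_antichain_colors_set fP antiB BQ cardB (ltn_ord i).
  have /(fintype.subsetP BR) := zB.
  rewrite inE fz eqxx xtop ?andbF//.
  by apply/on_antichainP; exists B.
have [g gP] := IHm w.-1 R (leq_ltn_trans (subset_leq_card RQ) cardQ) wR.
exists (fun y => if y \in R then g y else w.-1); split=> [y yP|y z yP zP].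
  apply: (@leq_trans w); last exact: goodk.
  case: ifP => [/gP.1 gy|_]; last by rewrite prednK.
  by rewrite (leq_trans gy)// leq_pred.
have below u : u \in P -> u \notin R ->
    u = a \/ (u \in Q /\ f u = i) /\ e u (x i).
  case: (eqVneq u a) => [|ua] uP; first by left.
  have uQ : u \in Q by rewrite !inE ua.
  by rewrite inE uQ negbK => /andP[/eqP]; right.
case: ifPn => yR; case: ifPn => zR.
- exact: gP.2.
- by move=> gy; have := gP.1 y yR; rewrite gy ltnn.
- by move=> gz; have := gP.1 z zR; rewrite -gz ltnn.
move=> _; have [->|[[yQ fy] ey]] := below y yP yR;
  have [->|[[zQ fz] ez]] := below z zP zR.
- by rewrite /related e_refl.
- by rewrite /related (e_trans ez exa) orbT.
- by rewrite /related (e_trans ey exa).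
- by apply: fP.2; rewrite ?fy ?fz.
Qed.

End FinitePreorder.

(** * Infinite preorders of finite width *)

Lemma dilworth_seq (V : choiceType) (e : rel V) n (s : seq V) :
  reflexive e -> transitive e ->
  (forall t : seq V, uniq t -> antichain e [in t] -> size t <= n) ->
  exists f, chain_coloring e n [in s] f.
Proof.
move=> e_refl e_trans width.
pose es : rel (seq_sub s) := fun x y => e (val x) (val y).
have [||B _ antiB|f [flt frel]] := @finite_dilworth _ es _ _ n [set: seq_sub s].
- by move=> x; apply: e_refl.
- by move=> y x z; apply: e_trans.
- rewrite cardE -(size_map val); apply: width.
    by rewrite (map_inj_uniq val_inj) enum_uniq.
  move=> _ _ /mapP[x xB ->] /mapP[y yB ->] xy; congr val.
  by apply: antiB xy; rewrite -mem_enum.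
exists (fun x => if insub x is Some u then f u else 0).
split=> [x xs|x y xs ys]; rewrite (insubT (mem s) xs).
  by apply: flt; rewrite inE.
by rewrite (insubT (mem s) ys); apply: frel; rewrite inE.
Qed.

Local Open Scope classical_set_scope.

(** An ultrafilter contains one of finitely many sets as soon as it contains
    their union; here the sets are the fibers of a bounded function. *)
Lemma ultra_bounded_fiber (I : Type) (U : set_system I) (h : I -> nat) n :
  UltraFilter U -> U [set s | h s < n] ->
  exists2 i, i < n & U [set s | h s = i].
Proof.
move=> UU; elim: n => [|n IHn] Uh.
  by have [s] := filter_ex Uh.
have [Un|Un] := in_ultra_setVsetC [set s | h s = n] UU; first by exists n.
have [|i ltin Ui] := IHn; last by exists i => //; apply: ltnW.
apply: filterS (filterI Uh Un) => s [/= hs /eqP hn].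
by rewrite ltn_neqAle hn -ltnS.
Qed.

(** The sets containing all lists that extend a given one form a proper filter:
    two such conditions both hold for a common extension. *)
Lemma seq_ultrafilter (V : eqType) :
  exists2 U : set_system (seq V), UltraFilter U &
    forall s0 : seq V, U [set s : seq V | {subset s0 <= s}].
Proof.
pose F : set_system (seq V) :=
  [set X | exists s0 : seq V, [set s : seq V | {subset s0 <= s}] `<=` X].
have FF : ProperFilter F.
  apply: Build_ProperFilter => [[s0 /(_ s0)]|]; first by apply.
  split=> [|X Y [s sX] [t tY]|X Y XY [s sX]].
  - by exists [::].
  - exists (s ++ t) => u stu; split; [apply: sX|apply: tY] => x xu;
      by apply: stu; rewrite mem_cat xu ?orbT.
  - by exists s; apply: subset_trans XY.
have [U [UU FU]] := ultraFilterLemma FF.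
by exists U => // s0; apply: FU; exists s0.
Qed.

(** The compactness argument: the limit of the colorings of finite lists along
    the ultrafilter is a coloring of the whole preorder. *)
Lemma dilworth (V : choiceType) (e : rel V) n :
  reflexive e -> transitive e ->
  (forall t : seq V, uniq t -> antichain e [in t] -> size t <= n) ->
  exists f, chain_coloring e n predT f.
Proof.
move=> e_refl e_trans width.
have [c cP] := choice (fun s => dilworth_seq s e_refl e_trans width).
have [U UU Usub] := seq_ultrafilter V.
have limit x : exists i, i < n /\ U [set s | c s x = i].
  have [|i] := @ultra_bounded_fiber _ U (c^~ x) n UU; last by exists i.
  apply: filterS (Usub [:: x]) => s /= xs; apply: (cP s).1.
  by apply: xs; rewrite mem_head.
have [f fP] := choice limit.
exists f; split=> [x _|x y _ _ fxy]; first exact: (fP x).1.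
(* Some list contains [x] and [y] and gives both their limit color. *)
have [s [[/= cx cy] sub]] :=
  filter_ex (filterI (filterI (fP x).2 (fP y).2) (Usub [:: x; y])).
apply: (cP s).2; last by rewrite cx cy.
  by apply: sub; rewrite mem_head.
by apply: sub; rewrite !inE eqxx orbT.
Qed.

(** * Power graphs *)

Section PowerGraph.
Variable G : groupType.

Definition power_rel : rel G := fun x y => `[< positive_power x y >].

Lemma power_rel_refl : reflexive power_rel.
Proof. by move=> x; apply/asboolP; exists 1. Qed.

Lemma power_rel_trans : transitive power_rel.
Proof.
move=> y x z /asboolP[m m0 ->] /asboolP[p p0 ->]; apply/asboolP.
by exists (m * p); rewrite ?muln_gt0 ?m0 ?expgnA.
Qed.

Lemma related_power_rel x y :
  related power_rel x y <-> positive_power x y \/ positive_power y x.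
Proof.
split=> [/orP[/asboolP|/asboolP]|[xy|yx]]; [by left|by right| |].
  by apply/orP; left; apply/asboolP.
by apply/orP; right; apply/asboolP.
Qed.

Lemma independent_antichain (A : set G) (B : {pred G}) :
  (forall x, A x <-> x \in B) ->
  independent (power_graph G) A <-> antichain power_rel B.
Proof.
move=> AB; split=> [indA x y /AB Ax /AB Ay /related_power_rel xy|antiB x y].
  by apply: contrapT => nxy; apply: (indA x y).
move=> /AB xB /AB yB [nxy /related_power_rel/antiB xy].
by apply: nxy; apply: xy.
Qed.

End PowerGraph.

Local Open Scope card_scope.

Lemma card_uniq_seq (T : choiceType) (s : seq T) :
  uniq s -> [set x | x \in s] #= `I_(size s).
Proof.
move=> us; have -> : [set x | x \in s] = [set` [fset x in s]%fset].
  by apply/seteqP; split=> x /=; rewrite inE.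
by apply/card_eq_fsetP; rewrite card_fseq undup_id.
Qed.

(** A clique contains at most one vertex of an independent set, so choosing for
    each vertex a part that contains it is injective on [A]. *)
Lemma independent_card_le_cover (V : Type) (Gr : sgraph V) (A : set V)
    (P : set (set V)) :
  independent Gr A -> clique_partition Gr P -> A #<= P.
Proof.
move=> indA [[coverP _ _] cliqueP].
have /choice[K KP] : forall x, exists K, P K /\ K x.
  by move=> x; have : [set: V] x by []; rewrite -coverP => -[K]; exists K.
have Kinj : {in A &, injective K}.
  move=> x y /set_mem Ax /set_mem Ay Kxy; apply: contrapT => nxy.
  have [PK Kx] := KP x; have [_ Ky] := KP y.
  by apply: (indA x y) => //; apply: cliqueP PK _ _ _ _ _ => //; rewrite Kxy.
rewrite -(card_le_eql (inj_card_eq Kinj)); apply: subset_card_le.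
by move=> _ [x _ <-]; apply: (KP x).1.
Qed.

Theorem corollary4 (G : groupType) (n : nat)
  (hn : is_independence_number (power_graph G) n) :
  is_clique_cover_number (power_graph G) n.
Proof.
have [[A indA An] width] := hn.
split; last first.
  move=> P partP; rewrite -(card_le_eql An).
  exact: independent_card_le_cover partP.
have [||t ut antit|f fP] := @dilworth G (@power_rel G) n.
- exact: power_rel_refl.
- exact: power_rel_trans.
- rewrite -card_le_II -(card_le_eql (card_uniq_seq ut)); apply: width.
  exact/(independent_antichain (B := [in t])).
have [flt frel] := fP.
(* The antichain [A] has [n] elements, so it meets every color class; this
   makes the classes nonempty and pairwise distinct. *)
have surj i : i < n -> exists x, f x = i.
  have finA : finite_set A by exists n.
  have At x : A x <-> x \in enum_fset (fset_set A).
    by rewrite -[_ \in _]/(x \in fset_set A) in_fset_set// inE.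
  have [antiA _] := independent_antichain At.
  move=> ltin.
  have [|||x _ <-] := full_antichain_colors fP (antiA indA) _ _ _ ltin.
  - by [].
  - exact: fset_uniq.
  - exact: card_fset_set.
  by exists x.
pose color i := [set x | f x = i].
exists (color @` `I_n); last first.
  apply: inj_card_eq => i j /set_mem/= /surj[x fx] _.
  move=> cij; have : color j x by rewrite -cij.
  by rewrite /color /= fx.
split; last first.
  move=> _ [i _ <-] x y /= fx fy nxy; split=> //.
  by apply/related_power_rel/frel; rewrite ?fx ?fy.
split.
- rewrite -subTset => x _; exists (color (f x)) => //.
  by exists (f x) => //; apply: flt.
- by move=> _ _ [i _ <-] [j _ <-] [x [/= <- <-]].
- by move=> _ [i ltin <-]; apply: surj.
Qed.
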